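(* Let $1<p<\infty$. Then, for any locally absolutely continuous function $u$ on $(0,\infty)$ with $\liminf_{r\to 0} |u(r)|=0$, $$ \int_0^\infty \max\left\{ \sup_{0< s\leq r} \frac{|u(s)|^p}{r^p}, \sup_{r\leq s<\infty} \frac{|u(s)|^p}{s^p} \right\} dr \leq \left(\frac{p}{p-1} \right)^p \int_0^\infty |u'(r)|^p\,dr \,. $$ *)

(* Defs.v *)
From HB Require Import structures.
From mathcomp Require Import all_boot all_order all_algebra.
From mathcomp Require Import all_classical all_reals all_analysis.
Set Implicit Arguments. Unset Strict Implicit. Unset Printing Implicit Defensive.
Import Order.TTheory GRing.Theory Num.Theory.
Local Open Scope ring_scope.

Definition abs_continuous_on (R : realType) (a b : R) (u : R -> R) : Prop :=
  forall e : R, 0 < e -> exists2 d : R, 0 < d &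
    forall s : seq (R * R),
      all (fun x => (a <= x.1) && (x.1 <= x.2) && (x.2 <= b)) s ->
      pairwise (fun x y => (x.2 <= y.1) || (y.2 <= x.1)) s ->
      \sum_(x <- s) (x.2 - x.1) < d ->
      \sum_(x <- s) `|u x.2 - u x.1| < e.

Definition loc_abs_continuous_pos (R : realType) (u : R -> R) : Prop :=
  forall a b : R, 0 < a -> a <= b -> abs_continuous_on a b u.

(* Main.v *)
Require Import Defs.
From HB Require Import structures.
From mathcomp Require Import all_boot all_order all_algebra.
From mathcomp Require Import all_classical all_reals all_analysis.
From mathcomp Require Import measurable_realfun lra ring.
Set Implicit Arguments. Unset Strict Implicit. Unset Printing Implicit Defensive.
Import Order.TTheory GRing.Theory Num.Theory.
Import numFieldTopology.Exports numFieldNormedType.Exports.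
Local Open Scope classical_set_scope.
Local Open Scope ring_scope.

(** Write [q = p / (p - 1)].  Local absolute continuity and [liminf |u| = 0] give
    [|u s| <= F s], where [F s] is the integral of [|u'|] over [(0, s)].  As [F] is
    nondecreasing, both suprema at [r] are at most [sup_(s >= r) (F s / s)^p], so it is
    enough to bound the least decreasing majorant of the Hardy averages [F s / s].
    This is a Doob-type maximal inequality.  On a uniform grid, with [B_j] the partial
    sums of the cell means [b_i] and [g_k = max_(j >= k) B_(j+1) / (j+1)], Abel summation
    gives [sum g_i^p <= q sum b_i g_i^(p-1)], because [g] can only jump where the average
    attains the maximum; Young's inequality then absorbs [g].  Jensen on each cell and
    Fatou as the mesh tends to [0] give the continuous inequality.

    That [u] is a.e. differentiable and the integral of [u'] is obtained by writing [u] as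
    a difference of nondecreasing absolutely continuous functions, whose Stieltjes measures
    are absolutely continuous, so that Radon-Nikodym and Lebesgue differentiation apply. *)

(** * Discrete Hardy inequality for the tail maximum of averages *)

Section discrete_hardy.
Variables (R : realType) (p : R) (p1 : 1 < p).
Let q : R := p / (p - 1).

(** Young's inequality for the conjugate exponents [p] and [q] at [x] and [y^(p-1)], as
    [(p - 1) q = p]. It serves for absorption, integrability and Jensen alike. *)
Lemma young_powR (x y : R) : 0 <= x -> 0 <= y ->
  x * y `^ (p - 1) <= p^-1 * x `^ p + (1 - p^-1) * y `^ p.
Proof.
move=> x0 y0.
have p0 : 0 < p by exact: lt_trans ltr01 p1.
have pN0 : p != 0 by rewrite gt_eqF.
have p1N0 : p - 1 != 0 by rewrite gt_eqF// subr_gt0.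
have q0 : 0 < q by rewrite divr_gt0// subr_gt0.
have qE : q^-1 = 1 - p^-1 by rewrite /q; field; rewrite pN0 p1N0.
have pq : p^-1 + q^-1 = 1 by rewrite qE subrKC.
have := @conjugate_powR R x (y `^ (p - 1)) p q x0 (powR_ge0 _ _) p0 q0 pq.
have -> : (y `^ (p - 1)) `^ q = y `^ p by rewrite -powRrM /q mulrCA divff ?mulr1.
by rewrite qE ![_ * p^-1]mulrC [_ * (1 - p^-1)]mulrC.
Qed.

Variables (N : nat) (b : nat -> R) (b0 : forall i, 0 <= b i).
Let B n := \sum_(0 <= i < n) b i.

(** The default [0] of the empty maximum is harmless for nonnegative averages and makes the boundary
    term of the Abel summation vanish at [N]. *)
Definition tail_max (k : nat) : R := \big[Num.max/0]_(k <= j < N) (B j.+1 / j.+1%:R).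

Lemma tail_max_ge0 k : 0 <= tail_max k.
Proof.
rewrite /tail_max; elim/big_ind: _ => // [x y x0 y0|j _]; first by rewrite le_max x0.
by rewrite divr_ge0// sumr_ge0.
Qed.

Lemma tail_max_recl k : (k < N)%N ->
  tail_max k = Num.max (B k.+1 / k.+1%:R) (tail_max k.+1).
Proof. by move=> kN; rewrite /tail_max big_ltn. Qed.

Lemma tail_max_geN : tail_max N = 0.
Proof. by rewrite /tail_max big_geq. Qed.

Lemma tail_max_ub k j : (k <= j < N)%N -> B j.+1 / j.+1%:R <= tail_max k.
Proof.
by move=> kjN; rewrite /tail_max; apply: (@unstable.le_bigmax_seq _ R 0 nat _ j xpredT (fun j => B j.+1 / j.+1%:R)); rewrite ?mem_index_iota.
Qed.

(* For [k = N] the right-hand side vanishes.  The induction step is an equality when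
   [tail_max k = tail_max k.+1]; otherwise [tail_max k = B k.+1 / k.+1] and it is Young's
   inequality between the two values. *)
Lemma tail_max_abel k : (k <= N)%N ->
  \sum_(0 <= i < k) (tail_max i `^ p - q * b i * tail_max i `^ (p - 1)) <=
  k%:R * tail_max k `^ p - q * B k * tail_max k `^ (p - 1).
Proof.
have p0 : 0 < p by exact: lt_trans ltr01 p1.
have p10 : 0 < p - 1 by rewrite subr_gt0.
elim: k => [_|k IH kN].
  by rewrite /B !big_geq// mulr0 !mul0r subrr.
rewrite big_nat_recr//=; apply: le_trans (lerD (IH (ltnW kN)) (lexx _)) _.
have -> : B k.+1 = B k + b k by rewrite /B big_nat_recr.
rewrite tail_max_recl//.
have [gB|Bg] := leP (B k.+1 / k.+1%:R) (tail_max k.+1).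
  by rewrite -natr1; rewrite le_eqVlt; apply/orP; left; apply/eqP; ring.
set a := _ / _ in Bg *; set g := tail_max k.+1 in Bg *.
have g0 : 0 <= g by exact: tail_max_ge0.
have a0 : 0 <= a by rewrite (le_trans g0)// ltW.
have BE : B k + b k = k.+1%:R * a.
  by rewrite /a mulrCA divff ?mulr1// /B big_nat_recr.
clearbody a g.
have qE : 1 - q = - (p - 1)^-1 by rewrite /q; field; rewrite gt_eqF.
have qp : q * p^-1 = (p - 1)^-1 by rewrite /q; field; rewrite !gt_eqF.
have qp1 : q * (1 - p^-1) = 1 by rewrite /q; field; rewrite !gt_eqF.
(* The factor [q] turns Young's weights [p^-1] and [1 - p^-1] into [(p - 1)^-1 = q - 1] and [1];
   multiplied by [k.+1], the inequality is exactly the remaining gap. *)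
have := ler_wpM2l (ltW (divr_gt0 p0 p10)) (young_powR a0 g0).
rewrite -/q mulrDr !mulrA qp qp1 mul1r => Y.
have k0 : 0 <= k.+1%:R :> R by [].
have {}Y := ler_wpM2l k0 Y.
have aE := mulr_powRB1 a0 p0.
have -> : k%:R * a `^ p - q * B k * a `^ (p - 1) + (a `^ p - q * b k * a `^ (p - 1))
  = (1 - q) * k.+1%:R * a `^ p.
  rewrite -natr1.
  transitivity ((k%:R + 1) * a `^ p - q * (B k + b k) * a `^ (p - 1)); first by ring.
  rewrite BE -aE -natr1; ring.
rewrite BE qE; move: Y; rewrite -subr_ge0 => Y; rewrite -subr_ge0; apply: (le_trans Y).
by rewrite le_eqVlt; apply/orP; left; apply/eqP; ring.
Qed.

(** The Abel bound at [k = N] has right-hand side [0]. Young with [x = q b_i] and [y = g_i] leaves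
    [(1 - p^-1) sum g_i^p] on the right, which is absorbed on the left. *)
Lemma discrete_hardy :
  \sum_(0 <= i < N) tail_max i `^ p <= q `^ p * \sum_(0 <= i < N) b i `^ p.
Proof.
have p0 : 0 < p by exact: lt_trans ltr01 p1.
have p10 : 0 < p - 1 by rewrite subr_gt0.
have := tail_max_abel (leqnn N).
rewrite tail_max_geN !powR0 ?gt_eqF// !mulr0 subrr sumrB => /[!subr_le0] H.
have q0 : 0 <= q by rewrite ltW// divr_gt0.
have : \sum_(0 <= i < N) q * b i * tail_max i `^ (p - 1) <=
   \sum_(0 <= i < N) (p^-1 * (q `^ p * b i `^ p) + (1 - p^-1) * tail_max i `^ p).
  apply: ler_sum => i _; rewrite -powRM//; apply: young_powR; last exact: tail_max_ge0.
  by rewrite mulr_ge0.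
rewrite big_split/= -!mulr_sumr => /(le_trans H) {}H.
have : p^-1 * \sum_(0 <= i < N) tail_max i `^ p <= p^-1 * (q `^ p * \sum_(0 <= i < N) b i `^ p) by lra.
by rewrite ler_pM2l// invr_gt0.
Qed.

End discrete_hardy.

(** * Comparison of integrals and Jensen's inequality for powers *)

(* No measurability is assumed: the integral of a nonnegative function is the supremum of
   the integrals of the simple functions below it.  This is what allows integrands such as
   [derive1 u] and the suprema over [s], which are not shown to be measurable. *)
Lemma le_ge0_integral d (T : measurableType d) (R : realType)
    (mu : {measure set T -> \bar R}) (D : set T) (f g : T -> \bar R) :
  (forall x, D x -> 0 <= f x)%E -> (forall x, D x -> f x <= g x)%E ->
  (\int[mu]_(x in D) f x <= \int[mu]_(x in D) g x)%E.
Proof.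
move=> f0 fg.
have g0 x : D x -> (0 <= g x)%E by move=> Dx; rewrite (le_trans (f0 x Dx))// fg.
rewrite !ge0_integralE//; apply: ge_ereal_sup => _ [h hf <-].
apply: ereal_sup_ubound; exists h => // x; apply: (le_trans (hf x)).
by rewrite /patch; case: ifPn => //; rewrite inE => /fg.
Qed.

Lemma measurable_EFin_powR (R : realType) (p : R) (H : R -> R) (D : set R) :
  measurable_fun setT H -> measurable_fun D (EFin \o (fun x => H x `^ p)).
Proof.
move=> mH; apply: measurable_funTS; apply/measurable_EFinP.
by apply: (@measurableT_comp _ _ _ _ _ _ (fun x => x `^ p)) => //; exact: measurable_powR.
Qed.

Section powR_integral.
Variables (R : realType) (p : R) (p1 : 1 < p) (H : R -> R).
Hypotheses (mH : measurable_fun setT H) (H0 : forall x, 0 <= H x).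
Notation mu := (@lebesgue_measure R).

Let p0 : 0 < p. Proof. exact: lt_trans ltr01 p1. Qed.

(** Young's inequality with [y = 1] dominates [H] by [p^-1 H^p + (1 - p^-1)]. *)
Lemma integrable_powR (D : set R) : measurable D -> (mu D < +oo)%E ->
  (\int[mu]_(x in D) (H x `^ p)%:E < +oo)%E -> mu.-integrable D (EFin \o H).
Proof.
move=> mD muD Hp; apply/integrableP; split.
  by apply/measurable_EFinP; exact: measurable_funS mH.
apply: (@le_lt_trans _ _ (\int[mu]_(x in D) (p^-1%:E * (H x `^ p)%:E + (1 - p^-1)%:E))%E).
  apply: le_ge0_integral => [x _|x _]; first by rewrite abse_ge0.
  rewrite /= ger0_norm// -EFinM -EFinD lee_fin.
  by have := young_powR p1 (H0 x) ler01; rewrite !powR1 !mulr1.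
have p'0 : (0 <= (1 - p^-1)%:E :> \bar R)%E.
  by rewrite lee_fin subr_ge0 invf_le1// ltW.
rewrite ge0_integralD//=; last 2 first.
- by move=> x _; rewrite -EFinM lee_fin mulr_ge0// ?invr_ge0 ?powR_ge0 ?ltW.
- by apply: emeasurable_funM => //; exact: measurable_EFin_powR.
- rewrite ge0_integralZl//; last 3 first.
  + exact: measurable_EFin_powR.
  + by move=> x _; rewrite lee_fin powR_ge0.
  + by rewrite lee_fin invr_ge0 ltW.
  rewrite integral_cst// lte_add_pinfty// lte_mul_pinfty//.
  by rewrite lee_fin invr_ge0 ltW.
Qed.

(** Jensen's inequality, with Young's inequality at the mean [b] as tangent-line bound: integrating
    [b^(p-1) H <= p^-1 H^p + (1 - p^-1) b^p] over [D] gives [l b^p] on the left, and the terms in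
    [b^p] combine. *)
Lemma mean_powR_le (D : set R) (l : R) : measurable D -> 0 < l -> mu D = l%:E ->
  (\int[mu]_(x in D) (H x `^ p)%:E < +oo)%E ->
  (l%:E * ((l^-1 * \int[mu]_(x in D) H x) `^ p)%:E <= \int[mu]_(x in D) (H x `^ p)%:E)%E.
Proof.
move=> mD l0 muD Hp.
have iH : mu.-integrable D (EFin \o H).
  by apply: integrable_powR; rewrite ?muD ?ltry.
set b := l^-1 * _.
have b0 : 0 <= b by rewrite mulr_ge0 ?invr_ge0 ?(ltW l0)// Rintegral_ge0.
have Ifin : (\int[mu]_(x in D) (H x `^ p)%:E)%E \is a fin_num.
  by rewrite ge0_fin_numE// integral_ge0// => x _; rewrite lee_fin powR_ge0.
have IE : (\int[mu]_(x in D) (H x)%:E)%E = (l * b)%:E.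
  rewrite /b mulrA divff ?gt_eqF// mul1r /Rintegral fineK//.
  exact: integrable_fin_num.
have : (\int[mu]_(x in D) ((b `^ (p - 1))%:E * (H x)%:E) <=
   \int[mu]_(x in D) (p^-1%:E * (H x `^ p)%:E + ((1 - p^-1) * b `^ p)%:E))%E.
  apply: le_ge0_integral => [x _|x _]; first by rewrite -EFinM lee_fin mulr_ge0// powR_ge0.
  by rewrite -!EFinM -EFinD lee_fin mulrC young_powR.
have p'0 : 0 <= 1 - p^-1 by rewrite subr_ge0 invf_le1// ltW.
rewrite ge0_integralZl//; last 3 first.
- by apply/measurable_EFinP; exact: measurable_funS mH.
- by move=> x _; rewrite lee_fin.
- by rewrite lee_fin powR_ge0.
rewrite ge0_integralD//=; last 3 first.
- by move=> x _; rewrite -EFinM lee_fin mulr_ge0// ?invr_ge0 ?powR_ge0 ?ltW.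
- by apply: emeasurable_funM => //; exact: measurable_EFin_powR.
- by move=> x _; rewrite lee_fin mulr_ge0// powR_ge0.
- rewrite ge0_integralZl//; last 3 first.
  + exact: measurable_EFin_powR.
  + by move=> x _; rewrite lee_fin powR_ge0.
  + by rewrite lee_fin invr_ge0 ltW.
  rewrite integral_cst// IE [X in (_ + _ * X)%E](_ : _ = l%:E)// -(fineK Ifin) -!EFinM -EFinD !lee_fin.
  have := mulr_powRB1 b0 p0 => <-; set I := fine _ => Y.
  have : p^-1 * (l * (b * b `^ (p - 1))) <= p^-1 * I by lra.
  by rewrite ler_pM2l// invr_gt0.
Qed.

End powR_integral.

(** * Integrals over a grid and lower limits *)

Lemma ge0_integral_grid (R : realType) (f : R -> \bar R) (d : R) (N : nat) :
  measurable_fun setT f -> (forall x, 0 <= f x)%E -> 0 < d ->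
  (\sum_(0 <= i < N) \int[@lebesgue_measure R]_(x in `[(i%:R * d)%R, (i.+1%:R * d)%R[) f x =
   \int[@lebesgue_measure R]_(x in `[0%R, (N%:R * d)%R[) f x)%E.
Proof.
move=> mf f0 d0; elim: N => [|N IH].
  by rewrite big_geq// mul0r set_itv_ge ?bnd_simp ?ltxx// integral_set0.
have Nd0 : 0 <= N%:R * d by rewrite mulr_ge0// ltW.
have NdS : N%:R * d <= N.+1%:R * d by rewrite ler_pM2r// ler_nat.
rewrite big_nat_recr//= IH -ge0_integral_setU//=.
- by rewrite -itv_bndbnd_setU// bnd_simp.
- exact: measurable_funTS.
- apply/disj_setPLR => x /=; rewrite !in_itv/= => /andP[_ xN].
  by apply/negP; rewrite negb_and -ltNge xN.
Qed.

(** The threshold [n0] is there because the grids reach a given point only from some index on. *)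
Lemma le_limn_einf (R : realType) (u : (\bar R)^nat) (v : R^nat) (l : R) (n0 : nat) :
  v n @[n --> \oo] --> l -> (forall n, (n0 <= n)%N -> ((v n)%:E <= u n)%E) ->
  (l%:E <= limn_einf u)%E.
Proof.
move=> vl vu; rewrite limn_einf_lim.
apply/lee_addgt0Pr => e e0.
have /cvgrPdist_le/(_ _ e0)[m _ mP] := vl.
apply: (@le_trans _ _ (einfs u (maxn n0 m) + e%:E)%E).
  rewrite -leeBlDr//; apply: le_ereal_inf_tmp => _ [k /= nk <-].
  rewrite EFinN leeBlDr//.
  have /andP[n0k mk] : (n0 <= k)%N && (m <= k)%N by rewrite -geq_max.
  apply: (@le_trans _ _ ((v k)%:E + e%:E)%E); last by rewrite leeD// vu.
  by have := mP k mk; rewrite -EFinD lee_fin ler_norml => /andP[_]; lra.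
rewrite leeD//; apply: lime_ge; first exact: is_cvg_einfs.
by exists (maxn n0 m) => // k /= nk; exact: nondecreasing_einfs.
Qed.

Lemma limn_einf_le (R : realType) (u : (\bar R)^nat) (l : \bar R) :
  (forall n, (u n <= l)%E) -> (limn_einf u <= l)%E.
Proof.
move=> ul; rewrite limn_einf_lim; apply: lime_le; first exact: is_cvg_einfs.
by apply: nearW => n; apply: le_trans (ul n); apply: ereal_inf_lbound; exists n => /=.
Qed.

Lemma cvg_powR (R : realType) (p x : R) (v : R^nat) : 0 < x ->
  v n @[n --> \oo] --> x -> (v n `^ p) @[n --> \oo] --> x `^ p.
Proof.
move=> x0 vx; apply: (cvg_comp v (fun y => y `^ p) vx).
have /derivable1_diffP : derivable (fun y : R => y `^ p) x 1 by apply: derivable_powR; rewrite in_itv/= x0.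
exact: differentiable_continuous.
Qed.

(** * Maximal Hardy inequality on the half-line *)

Section hardy.
Variables (R : realType) (p : R) (p1 : 1 < p) (H : R -> R).
Hypotheses (mH : measurable_fun setT H) (H0 : forall x, 0 <= H x).
Notation mu := (@lebesgue_measure R).
Hypothesis Hp : (\int[mu]_(x in `[0%R, +oo[) (H x `^ p)%:E < +oo)%E.
Let q : R := p / (p - 1).
Let F (s : R) : R := \int[mu]_(x in `[0, s[) H x.

Let p0 : 0 < p. Proof. exact: lt_trans ltr01 p1. Qed.

Let Hp0 x : (0 <= (H x `^ p)%:E)%E. Proof. by rewrite lee_fin powR_ge0. Qed.

Let mHp : measurable_fun [set: R] (EFin \o (fun x => H x `^ p)).
Proof. exact: measurable_EFin_powR. Qed.

Let Hpfin (i : interval R) : [set` i] `<=` `[0, +oo[ ->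
  (\int[mu]_(x in [set` i]) (H x `^ p)%:E < +oo)%E.
Proof.
move=> i0; apply: le_lt_trans Hp.
by apply: ge0_subset_integral => //; exact: measurable_funTS.
Qed.

Lemma integrable_bounded_powR (a b : R) : 0 <= a -> mu.-integrable `[a, b[ (EFin \o H).
Proof.
move=> a0; apply: (integrable_powR p1 mH H0) => //.
  by rewrite lebesgue_measure_itv/=; case: ifPn => // _; rewrite -EFinB ltry.
by apply: Hpfin; apply: subset_itv; rewrite bnd_simp.
Qed.

Lemma primitive_ge0 s : 0 <= F s.
Proof. exact: Rintegral_ge0. Qed.

Lemma EFin_primitive s : (F s)%:E = (\int[mu]_(x in `[0%R, s[) (H x)%:E)%E.
Proof.
by rewrite /F /Rintegral fineK//; apply: integrable_fin_num => //; exact: integrable_bounded_powR.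
Qed.

Lemma nondecreasing_primitive s t : s <= t -> F s <= F t.
Proof.
move=> st; rewrite -lee_fin !EFin_primitive; apply: ge0_subset_integral => //.
- by apply/measurable_EFinP; exact: measurable_funTS.
- by move=> x _; rewrite lee_fin.
- by apply: subset_itv; rewrite bnd_simp.
Qed.

Section grid.
Variables (d : R) (d0 : 0 < d) (N : nat).
Let b (i : nat) : R := d^-1 * \int[mu]_(x in `[i%:R * d, i.+1%:R * d[) H x.

Let cell_ge0 (i : nat) : 0 <= i%:R * d.
Proof. by rewrite mulr_ge0// ltW. Qed.

Let b_ge0 i : 0 <= b i.
Proof. by rewrite mulr_ge0 ?invr_ge0 ?(ltW d0)// Rintegral_ge0. Qed.

Lemma sum_cell_means n : \sum_(0 <= i < n) b i = d^-1 * F (n%:R * d).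
Proof.
rewrite -mulr_sumr; congr (_ * _); apply: EFin_inj.
rewrite EFin_primitive -ge0_integral_grid//; last exact/measurable_EFinP.
rewrite -sumEFin; apply: eq_bigr => i _.
by rewrite /Rintegral fineK//; apply: integrable_fin_num => //; exact: integrable_bounded_powR.
Qed.

Let cell_measure (i : nat) : mu `[i%:R * d, i.+1%:R * d[ = d%:E.
Proof.
rewrite lebesgue_measure_itv/= lte_fin ltr_pM2r// ltr_nat ltnSn -EFinB -mulrBl.
by rewrite -natrB// subSnn mul1r.
Qed.

Definition grid_max (r : R) : \bar R :=
  (\sum_(0 <= i < N) (tail_max N b i `^ p * \1_(`[i%:R * d, i.+1%:R * d[) r)%:E)%E.

Lemma grid_max_ge0 r : (0 <= grid_max r)%E.
Proof. by rewrite sume_ge0// => i _; rewrite lee_fin mulr_ge0 ?powR_ge0. Qed.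

Lemma measurable_grid_max (D : set R) : measurable_fun D grid_max.
Proof.
apply: measurable_funTS; apply: emeasurable_sum => i.
apply/measurable_EFinP; apply: measurable_funM => //.
Qed.

(** Each cell contributes [d g_i^p]. In the sum, the discrete inequality replaces this by
    [q^p d b_i^p], and Jensen bounds [d b_i^p] by the integral of [H^p] over the cell. *)
Lemma integral_grid_max :
  (\int[mu]_(r in `[0%R, +oo[) grid_max r <=
   (q `^ p)%:E * \int[mu]_(r in `[0%R, +oo[) (H r `^ p)%:E)%E.
Proof.
rewrite ge0_integral_sum//; last 2 first.
- move=> i; apply/measurable_EFinP; apply: measurable_funM => //.
- by move=> i x _; rewrite lee_fin mulr_ge0 ?powR_ge0.
have cell i : (\int[mu]_(r in `[0%R, +oo[) (tail_max N b i `^ p * \1_(`[(i%:R * d)%R, (i.+1%:R * d)%R[) r)%:E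
    = (tail_max N b i `^ p)%:E * d%:E)%E.
  under eq_integral do rewrite EFinM.
  rewrite ge0_integralZl//; last 2 first.
  - exact/measurable_EFinP.
  - by rewrite lee_fin powR_ge0.
  rewrite integral_indic// setIidl; last by apply: subset_itv; rewrite bnd_simp.
  by congr (_ * _)%E; exact: cell_measure.
rewrite (eq_bigr _ (fun i _ => cell i)) sumEFin -mulr_suml.
have := discrete_hardy p1 N b_ge0 => /(ler_wpM2r (ltW d0)); rewrite -lee_fin => /le_trans; apply.
rewrite -/q -mulrA EFinM; apply: lee_pmul => //; first by rewrite lee_fin powR_ge0.
  by rewrite lee_fin mulr_ge0 ?(ltW d0)// sumr_ge0// => i _; rewrite powR_ge0.
rewrite mulr_suml -sumEFin.
apply: (@le_trans _ _ (\int[mu]_(r in `[0%R, (N%:R * d)%R[) (H r `^ p)%:E)%E); last first.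
  apply: ge0_subset_integral => //; first exact: measurable_funTS.
  by apply: subset_itv; rewrite bnd_simp.
rewrite -ge0_integral_grid//; apply: lee_sum => i _; rewrite mulrC EFinM.
apply: (mean_powR_le p1 mH H0) => //; apply: Hpfin.
by apply: subset_itv; rewrite bnd_simp.
Qed.

(** With [r] in cell [i] and [s] in cell [j >= i], rounding [s] up to [(j+1) d] increases [F], and
    [(j+1) d <= s + d] controls the denominator. The resulting quotient is the average
    [B_(j+1) / (j+1)], one of those under the maximum [g_i]. *)
Lemma grid_max_lb r s : 0 <= r -> r <= s -> s < N%:R * d ->
  (((F s / (s + d)) `^ p)%:E <= grid_max r)%E.
Proof.
move=> r0 rs sN; have s0 := le_trans r0 rs.
have sd0 : 0 <= s / d by rewrite divr_ge0// ltW.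
have rd0 : 0 <= r / d by rewrite divr_ge0// ltW.
set i := Num.truncn (r / d); set j := Num.truncn (s / d).
have ij : (i <= j)%N by apply: le_truncn; rewrite ler_pM2r ?invr_gt0.
have jN : (j < N)%N by rewrite truncn_lt_nat// ltr_pdivrMr.
have := truncn_itv sd0; rewrite -/j ler_pdivlMr// ltr_pdivrMr// => /andP[js sj].
have := truncn_itv rd0; rewrite -/i ler_pdivlMr// ltr_pdivrMr// => ri.
rewrite /grid_max (bigD1_seq i)/= ?iota_uniq ?mem_index_iota ?(leq_ltn_trans ij)//.
rewrite indicE mem_set/= ?in_itv//= mulr1.
apply: (@le_trans _ _ (tail_max N b i `^ p)%:E); last first.
  by rewrite leeDl// sume_ge0// => k _; rewrite lee_fin mulr_ge0 ?powR_ge0.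
rewrite lee_fin; apply: ge0_ler_powR; rewrite ?nnegrE ?(ltW p0)//.
- by rewrite divr_ge0 ?primitive_ge0// addr_ge0// ltW.
- exact: tail_max_ge0.
- have /(tail_max_ub b) : (i <= j < N)%N by rewrite ij.
  apply: le_trans; rewrite sum_cell_means mulrAC -invfM mulrC.
  rewrite ler_pM ?primitive_ge0 ?invr_ge0 ?addr_ge0 ?(ltW d0)//; last exact/nondecreasing_primitive/ltW.
  rewrite lef_pV2 ?posrE ?mulr_gt0 ?ltr_wpDl//.
  by rewrite -natr1 mulrC mulrDl mul1r lerD2r.
Qed.

End grid.

Lemma hardy_tail_sup :
  (\int[mu]_(r in `]0%R, +oo[)
      ereal_sup [set ((F s / s) `^ p)%:E | s in `[r, +oo[%classic] <=
   (q `^ p)%:E * \int[mu]_(r in `]0%R, +oo[) (H r `^ p)%:E)%E.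
Proof.
have dn0 (n : nat) : 0 < n.+1%:R^-1 :> R by [].
(* With mesh [1/(n+1)], [(n+1)^2] cells cover [[0, n+1[]: the mesh vanishes while the grids exhaust
   the half-line. *)
pose G n r := grid_max n.+1%:R^-1 (n.+1 * n.+1) r.
have G0 n r : (0 <= G n r)%E by exact: grid_max_ge0.
have mG n (D : set R) : measurable_fun D (G n) by exact: measurable_grid_max.
have lower r : 0 < r -> (ereal_sup [set ((F s / s) `^ p)%:E | s in `[r, +oo[%classic] <= limn_einf (G ^~ r))%E.
  move=> r0.
  apply: ge_ereal_sup => _ [s + <-]; rewrite /= in_itv/= andbT => rs.
  have s0 := lt_le_trans r0 rs.
  (* Continuity of the power is used only at positive points, so a vanishing [F s] is treated
     apart. *)
  have [->|Fs0] := eqVneq (F s) 0.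
    rewrite mul0r powR0 ?gt_eqF//.
    apply: (@le_limn_einf _ _ (fun=> 0) _ 0) => [|n _]; [exact: cvg_cst|exact: G0].
  apply: (@le_limn_einf _ _ (fun n => (F s / (s + n.+1%:R^-1)) `^ p) _ (Num.truncn s)).
    apply: cvg_powR; first by rewrite divr_gt0// lt_neqAle eq_sym Fs0 primitive_ge0.
    apply: cvgM; first exact: cvg_cst.
    apply: cvgV; first by rewrite gt_eqF.
    by rewrite -[X in _ --> X]addr0; apply: cvgD; [exact: cvg_cst|exact: cvg_harmonic].
  move=> n sn; apply: grid_max_lb => //; first exact: ltW.
  rewrite natrM mulfK//; apply: lt_le_trans (truncnS_gt s) _.
  by rewrite ler_nat.
apply: (@le_trans _ _ (\int[mu]_(r in `]0%R, +oo[) limn_einf (G ^~ r))%E).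
  apply: le_ge0_integral => r /=; rewrite in_itv/= andbT => r0; last first.
    exact: lower.
  apply: (@le_trans _ _ ((F r / r) `^ p)%:E); first by rewrite lee_fin powR_ge0.
    by apply: ereal_sup_ubound; exists r => //=; rewrite in_itv/= lexx.
apply: (le_trans (fatou mu _ _ _)) => //=; first by move=> n; exact: mG.
apply: limn_einf_le => n; apply: (@le_trans _ _ (\int[mu]_(r in `[0%R, +oo[) G n r)%E).
  by apply: ge0_subset_integral => //; [exact: mG|apply: subset_itv; rewrite bnd_simp].
rewrite integral_itv_obnd_cbnd; last exact: measurable_funTS.
exact: integral_grid_max.
Qed.

End hardy.

(** * Total variation under absolute continuity *)

Section abs_continuous_total_variation.
Variable R : realType.
Implicit Types (a b c d e x y : R) (u v : R -> R) (l : seq R) (s t : seq (R * R)).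

Let nonoverlap : rel (R * R) := fun (x y : R * R) => (x.2 <= y.1) || (y.2 <= x.1).
Let subitv a b : pred (R * R) := fun (x : R * R) => (a <= x.1) && (x.1 <= x.2) && (x.2 <= b).
Let cells x l := zip (x :: l) l.

Let subitvS a b (z w : R * R) : subitv a b z -> subitv z.1 z.2 w -> subitv a b w.
Proof.
rewrite /subitv => /andP[/andP[az zz] zb] /andP[/andP[zw ww] wz].
by rewrite (le_trans az zw) ww (le_trans wz zb).
Qed.

Let cells_itv x l : path <%R x l -> all (subitv x (last x l)) (cells x l).
Proof.
elim: l x => //= h l IH x /andP[xh hl]; apply/andP; split.
  by rewrite /subitv/= lexx (ltW xh)/= unstable.path_lt_le_last.
apply: sub_all (IH _ hl) => z; rewrite /subitv => /andP[/andP[hz ->] ->].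
by rewrite (le_trans (ltW xh) hz).
Qed.

Let cells_pairwise x l : path <%R x l -> pairwise nonoverlap (cells x l).
Proof.
elim: l x => //= h l IH x /andP[xh hl]; rewrite (IH _ hl) andbT.
apply: sub_all (cells_itv hl) => z /andP[/andP[hz _] _].
by rewrite /nonoverlap hz.
Qed.

Let cells_length x l : \sum_(z <- cells x l) (z.2 - z.1) = last x l - x.
Proof.
elim: l x => [x|h l IH x] /=; first by rewrite big_nil subrr.
by rewrite big_cons/= IH; ring.
Qed.

Let variation_cells x y u l : itv_partition x y l ->
  variation x y u l = \sum_(z <- cells x l) `|u z.2 - u z.1|.
Proof.
elim: l x => [x _|h l IH x]; first by rewrite /variation !big_nil.
rewrite /itv_partition /variation => -[]/= /andP[xh hl] /eqP hy.
rewrite big_nat_recl//= big_cons/=; congr +%R.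
by rewrite -IH//; split => //; exact/eqP.
Qed.

(* The induction moves the intervals of [t] one at a time to [s], each one replaced by the
   cells of an arbitrary partition of it. *)
Lemma abs_continuous_sum_total_variation a b u d e :
  (forall s, all (subitv a b) s -> pairwise nonoverlap s ->
    \sum_(x <- s) (x.2 - x.1) < d -> \sum_(x <- s) `|u x.2 - u x.1| < e) ->
  forall t s, all (subitv a b) (s ++ t) -> pairwise nonoverlap (s ++ t) ->
    \sum_(x <- s ++ t) (x.2 - x.1) < d ->
  ((\sum_(x <- s) `|u x.2 - u x.1|)%:E +
    \sum_(x <- t) total_variation x.1 x.2 u <= e%:E)%E.
Proof.
move=> ac; elim=> [s|[x y] t IH s].
  by rewrite cats0 => *; rewrite big_nil adde0 lee_fin ltW// ac.
rewrite all_cat /= => /and3P[sab xyab tab].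
rewrite pairwise_cat/= allrel_consr => /and4P[/andP[sxy st] sp xyt tp].
rewrite big_cat big_cons/= => len.
have xy : x <= y by case/andP: xyab => /andP[].
have main l : itv_partition x y l ->
  ((\sum_(x <- s) `|u x.2 - u x.1|)%:E + ((variation x y u l)%:E +
    \sum_(x <- t) total_variation x.1 x.2 u) <= e%:E)%E.
  move=> xyl; have [xl /eqP ly] := xyl.
  have cl : all (subitv x y) (cells x l) by rewrite -ly; exact: cells_itv.
  rewrite addeA -EFinD (variation_cells _ xyl) -big_cat/=; apply: IH.
  - rewrite all_cat all_cat sab tab andbT/=.
    by apply: sub_all cl => z; exact: subitvS xyab.
  - rewrite !pairwise_cat allrel_catl st sp tp cells_pairwise//= !andbT.
    apply/andP; split; last first.
      apply/allrelP => z w zs wl; have := allP sxy z zs; have := allP cl w wl.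
      rewrite /subitv /nonoverlap/= => /andP[/andP[xw _] wy] /orP[zx|yz].
        by rewrite (le_trans zx xw).
      by rewrite (le_trans wy yz) orbT.
    apply/allrelP => w z wl zt; have := allP xyt z zt; have := allP cl w wl.
    rewrite /subitv /nonoverlap/= => /andP[/andP[xw _] wy] /orP[yz|zx].
      by rewrite (le_trans wy yz).
    by rewrite (le_trans zx xw) orbT.
  - by rewrite !big_cat/= cells_length ly -addrA.
(* Finiteness lets the sum over [t] move to the right before the supremum over partitions is taken.
   It follows from [main] for any one partition, the empty one if [x = y]. *)
have Sfin : (\sum_(x <- t) total_variation x.1 x.2 u)%E \is a fin_num.
  rewrite ge0_fin_numE; last first.
    rewrite big_seq sume_ge0// => z zt; apply: total_variation_ge0.
    by have := allP tab z zt => /andP[/andP[]].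
  have [l xyl] : exists l, itv_partition x y l.
    move: xy; rewrite le_eqVlt => /predU1P[->|xy]; first by exists [::]; split.
    by exists [:: y]; exact: itv_partition1.
  have := main l xyl; rewrite addeA -EFinD addeC => /le_lt_trans.
  by move=> /(_ _ (ltry e)); set S := bigop.body _ _ _; case: S => [r|//|]; rewrite ?ltry ?ltNyr.
rewrite big_cons/= addeCA -leeBrDr; last by rewrite fin_numD.
apply: ge_ereal_sup => _ [_ [l xyl <-] <-].
rewrite leeBrDr; last by rewrite fin_numD.
by rewrite addeCA; exact: main.
Qed.

End abs_continuous_total_variation.

(** * Bounded variation and Jordan decomposition *)

Section abs_continuous_on.
Variable R : realType.
Implicit Types (a b d e x y : R) (u v : R -> R).

Lemma abs_continuous_on_total_variation a b u : abs_continuous_on a b u ->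
  forall e, 0 < e -> exists2 d, 0 < d &
    forall s : seq (R * R),
      all (fun z => (a <= z.1) && (z.1 <= z.2) && (z.2 <= b)) s ->
      pairwise (fun z w => (z.2 <= w.1) || (w.2 <= z.1)) s ->
      \sum_(z <- s) (z.2 - z.1) < d ->
      (\sum_(z <- s) total_variation z.1 z.2 u <= e%:E)%E.
Proof.
move=> uac e /uac[d d0 du]; exists d => // s sab sp sd.
have := abs_continuous_sum_total_variation du (t := s) (s := [::]) sab sp sd.
by rewrite big_nil add0e.
Qed.

(** Absolute continuity with [e = 1] bounds the variation on intervals shorter than [d] by [1], and
    finitely many of these make up [[a, b]]. *)
Lemma abs_continuous_on_bounded_variation a b u : a <= b ->
  abs_continuous_on a b u -> bounded_variation a b u.
Proof.
move=> ab /abs_continuous_on_total_variation /(_ _ ltr01)[d d0 du].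
have TV1 x y : a <= x -> x <= y -> y <= b -> y - x < d ->
    (total_variation x y u <= 1%:E)%E.
  move=> ax xy yb xyd; have := du [:: (x, y)].
  by rewrite /= !big_seq1/= ax xy yb; exact.
pose h := d / 2; have h0 : 0 < h by rewrite divr_gt0.
pose y n := Num.min b (a + n%:R * h).
have ay n : a <= y n by rewrite le_min ab lerDl mulr_ge0// ltW.
have yb n : y n <= b by rewrite ge_min lexx.
have yS n : y n <= y n.+1.
  by rewrite le_min yb ge_min lerD2l ler_pM2r// ler_nat leqnSn orbT.
have ySd n : y n.+1 - y n < d.
  have hd : h < d by rewrite /h; lra.
  rewrite /y -natr1 mulrDl mul1r.
  by case: (leP b (a + n%:R * h)) => ?; case: (leP b (a + (n%:R * h + h))) => ?; lra.
have fin n : (total_variation a (y n) u < +oo)%E.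
  elim: n => [|n IH].
    by rewrite /y mul0r addr0 min_r// total_variationxx.
  rewrite (total_variationD _ (ay n) (yS n)) lte_add_pinfty//.
  by apply: le_lt_trans (TV1 _ _ _ _ _ _) _ => //; rewrite ltry.
apply/bounded_variationP => //; rewrite ge0_fin_numE ?total_variation_ge0//.
have := fin (Num.truncn ((b - a) / h)).+1.
rewrite /y min_l//; rewrite -lerBlDl -ler_pdivrMr//; exact/ltW/truncnS_gt.
Qed.

Lemma abs_continuous_onB a b u v : abs_continuous_on a b u ->
  abs_continuous_on a b v -> abs_continuous_on a b (u \- v).
Proof.
move=> uac vac e e0; have e20 : 0 < e / 2 by rewrite divr_gt0.
have [d d0 du] := uac _ e20; have [d' d'0 dv] := vac _ e20.
exists (Num.min d d') => [|s sab sp]; first by rewrite lt_min d0.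
rewrite lt_min => /andP[sd sd']; rewrite [e]splitr.
apply: le_lt_trans (ltrD (du _ sab sp sd) (dv _ sab sp sd')).
rewrite -big_split/=; apply: ler_sum => z _.
have -> : u z.2 - v z.2 - (u z.1 - v z.1) = (u z.2 - u z.1) - (v z.2 - v z.1) by ring.
exact: ler_normB.
Qed.

Let tv a u x := fine (total_variation a x u).

Lemma total_variation_fineB a b u x y : abs_continuous_on a b u ->
  a <= x -> x <= y -> y <= b ->
  total_variation x y u = (tv a u y - tv a u x)%:E.
Proof.
move=> uac ax xy yb; have ab : a <= b by rewrite (le_trans ax)// (le_trans xy).
have bv := abs_continuous_on_bounded_variation ab uac.
have ay := le_trans ax xy; have xb := le_trans xy yb.
have axf : total_variation a x u \is a fin_num.
  by apply/(bounded_variationP _ ax); exact: bounded_variationl bv.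
have xyf : total_variation x y u \is a fin_num.
  apply/(bounded_variationP _ xy); apply: (bounded_variationl xy yb).
  exact: bounded_variationr bv.
rewrite /tv (total_variationD _ ax xy) fineD// [X in (X - _)%R]addrC addrK.
by rewrite fineK.
Qed.

Lemma abs_continuous_on_tv a b u : abs_continuous_on a b u ->
  abs_continuous_on a b (tv a u).
Proof.
move=> uac e e0; have e20 : 0 < e / 2 by rewrite divr_gt0.
have [d d0 du] := abs_continuous_on_total_variation uac e20.
exists d => // s sab sp sd; apply: (@le_lt_trans _ _ (e / 2)); last by lra.
rewrite -lee_fin; apply: le_trans (du s sab sp sd).
rewrite -sumEFin big_seq [leRHS]big_seq; apply: lee_sum => z zs.
have /andP[/andP[az zz] zb] := allP sab z zs.
rewrite ger0_norm; first by rewrite (total_variation_fineB uac).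
by rewrite -lee_fin -(total_variation_fineB uac)// total_variation_ge0.
Qed.

(** Jordan decomposition [u = V - (V - u)] with [V] the variation function; [V - u] is nondecreasing
    because an increment of [u] is at most the variation over the same interval. *)
Lemma abs_continuous_on_nondecreasing_decomposition a b u :
  abs_continuous_on a b u ->
  exists f g : R -> R, [/\ u = f \- g,
    abs_continuous_on a b f, {in `[a, b] &, {homo f : x y / x <= y}},
    abs_continuous_on a b g & {in `[a, b] &, {homo g : x y / x <= y}}].
Proof.
move=> uac; have tvac := abs_continuous_on_tv uac.
exists (tv a u), (tv a u \- u); split => //.
- by apply/funext => x /=; rewrite opprB addrC subrK.
- move=> x y; rewrite !in_itv/= => /andP[ax xb] /andP[ay yb] xy.
  by rewrite -subr_ge0 -lee_fin -(total_variation_fineB uac)// total_variation_ge0.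
- exact: abs_continuous_onB.
- move=> x y; rewrite !in_itv/= => /andP[ax xb] /andP[ay yb] xy.
  rewrite -subr_ge0.
  have -> : tv a u y - u y - (tv a u x - u x) = (tv a u y - tv a u x) - (u y - u x) by ring.
  rewrite subr_ge0.
  apply: le_trans (ler_norm _) _; rewrite -lee_fin -(total_variation_fineB uac)//.
  exact: total_variation_ge.
Qed.

End abs_continuous_on.

(** * Stieltjes measures and Radon-Nikodym densities *)

Lemma open_itv_endpoints (R : realType) (I : set R) (a b : R) : open I -> is_interval I ->
  a <= b -> exists p : R * R, [/\ (a <= p.1) && (p.1 <= p.2) && (p.2 <= b),
    I `&` `]a, b] `<=` `]p.1, p.2],
    `]p.1, p.2[ `<=` I `&` `]a, b] & p.1 < p.2 \/ p = (a, a)].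
Proof.
move=> oI iI ab; set J := I `&` _.
have Jab z : J z -> a < z <= b by move=> [_ /=]; rewrite in_itv.
have [J0|/set0P J0] := eqVneq J set0.
  (* An empty trace gets the degenerate pair [(a, a)], which has length zero and overlaps no
     interval inside [[a, b]]. *)
  exists (a, a); rewrite J0 lexx; split => //; last by right.
  by move=> z /=; rewrite in_itv/= => /andP[az /(lt_trans az)]; rewrite ltxx.
have lJ : has_lbound J by exists a => z /Jab/andP[/ltW].
have uJ : has_ubound J by exists b => z /Jab/andP[].
have infJ z : J z -> inf J < z.
  move=> Jz; have /andP[az zb] := Jab _ Jz.
  have /nbhs_ballP[e /= e0 eI] : nbhs z I by apply: open_nbhs_nbhs; split => //; exact: Jz.1.
  (* As [I] is open, [J] contains a point [w] to the left of [z], close enough to [z] and still to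
     the right of [a]; hence [inf J] is not attained. *)
  pose w := Num.max (z - e / 2) ((a + z) / 2).
  have e20 : 0 < e / 2 by rewrite divr_gt0.
  have wz : w < z by rewrite /w gt_max; apply/andP; split; lra.
  have zw : z - e / 2 <= w by rewrite /w le_max lexx.
  have aw : a < w by rewrite /w lt_max; apply/orP; right; lra.
  apply: (le_lt_trans _ wz); apply: (ge_inf lJ); split; last first.
    by rewrite /= in_itv/= aw/= (le_trans (ltW wz)).
  apply: eI; rewrite /ball/= ltr_norml; apply/andP; split; lra.
have [z Jz] := J0.
have supJ : z <= sup J by exact: ub_le_sup.
exists (inf J, sup J) => /=; split.
- apply/andP; split; first (apply/andP; split).
  + by apply: lb_le_inf => // w /Jab/andP[/ltW].
  + by rewrite (le_trans _ supJ)// ltW// infJ.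
  + by apply: ge_sup => // w /Jab/andP[].
- by move=> w Jw; rewrite /= in_itv/= infJ//= ub_le_sup.
- move=> w /=; rewrite in_itv/= => /andP[/(inf_lt J0)[x Jx xw] /(sup_gt J0)[y Jy wy]].
  split; first by apply: (iI x y Jx.1 Jy.1); rewrite !ltW.
  have /andP[ax _] := Jab _ Jx; have /andP[_ yb] := Jab _ Jy.
  by rewrite /= in_itv/= (lt_trans ax xw) (le_trans (ltW wy) yb).
- by left; exact: lt_le_trans (infJ _ Jz) supJ.
Qed.

Section stieltjes.
Variables (R : realType) (a b : R) (g : R -> R).
Hypotheses (ab : a <= b) (gac : abs_continuous_on a b g).
Hypothesis (gnd : {in `[a, b] &, {homo g : x y / x <= y}}).
Notation mu := (@lebesgue_measure R).

Let clamp x := Num.max a (Num.min x b).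

Let clamp_itv x : a <= clamp x <= b.
Proof. by rewrite /clamp le_max lexx ge_max ab ge_min lexx orbT. Qed.

Let clamp_id x : a <= x <= b -> clamp x = x.
Proof. by move=> /andP[ax xb]; rewrite /clamp min_l// max_r. Qed.

Let clamp_nd x y : x <= y -> clamp x <= clamp y.
Proof.
move=> xy; rewrite /clamp ge_max le_max lexx/= le_max; apply/orP; right.
by rewrite le_min !ge_min xy lexx orbT.
Qed.

Let clamp_le x y : x <= y -> clamp y - clamp x <= y - x.
Proof.
move=> xy; rewrite /clamp.
have [?|?] := leP x b; have [?|?] := leP y b; try (have [?|?] := leP a x);
  try (have [?|?] := leP a y); try (have [?|?] := leP a b); lra.
Qed.

(** Extends [g] by constants outside [[a, b]], since a cumulative function must be nondecreasing and
    right-continuous on the whole line. *)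
Let G x := g (clamp x).

Let G_nd : {homo G : x y / x <= y}.
Proof. by move=> x y xy; apply: gnd; rewrite ?in_itv/= ?clamp_itv//; exact: clamp_nd. Qed.

Let G_rc x : G @ x^'+ --> G x.
Proof.
apply/cvgrPdist_lt => e /gac[d d0 dg].
near=> y; have xy : x <= y by apply: ltW; near: y; exact: nbhs_right_gt.
have yd : y < x + d by near: y; apply: nbhs_right_lt; rewrite ltrDl.
have := dg [:: (clamp x, clamp y)].
rewrite /= !big_seq1/= !andbT clamp_nd// andbT distrC.
have /andP[-> _] := clamp_itv x; have /andP[_ ->] := clamp_itv y.
apply => //; apply: le_lt_trans (clamp_le xy) _; lra.
Unshelve. all: by end_near. Qed.

Definition clamped_cumulative : cumulative R R :=
  HB.pack G (isCumulative.Build R _ R G G_nd G_rc).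

Let nu : {measure set (measurableTypeR R) -> \bar R} :=
  lebesgue_stieltjes_measure clamped_cumulative.

Lemma stieltjes_itv x y : x <= y -> nu `]x, y]%classic = (G y - G x)%:E.
Proof.
move=> xy; rewrite /nu/= /lebesgue_stieltjes_measure /measure_extension.
by rewrite measurable_mu_extE/=; [rewrite wlength_itv_bnd|exact: is_ocitv].
Qed.

(* The disjoint open components of [U], cut down to [`]a, b]], form a family to which the
   absolute continuity of [g] applies. *)
Lemma stieltjes_open_le (e d : R) (U : set R) :
  (forall s : seq (R * R),
      all (fun x => (a <= x.1) && (x.1 <= x.2) && (x.2 <= b)) s ->
      pairwise (fun x y => (x.2 <= y.1) || (y.2 <= x.1)) s ->
      \sum_(x <- s) (x.2 - x.1) < d ->
      \sum_(x <- s) `|g x.2 - g x.1| < e) ->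
  open U -> (mu U < d%:E)%E -> (nu (U `&` `]a, b]) <= e%:E)%E.
Proof.
move=> dg oU Ud; pose I := open_disjoint_itv oU.
have mJ k : measurable (I k `&` `]a, b]).
  apply: measurableI => //; apply: is_interval_measurable.
  exact: open_disjoint_itv_is_interval.
have tJ : trivIset setT (fun k => I k `&` `]a, b]).
  exact/trivIset_setIr/open_disjoint_itv_trivIset.
have [p /all_and4[pab Jp pJ pnd]] := choice (fun k => open_itv_endpoints
  (@open_disjoint_itv_open _ _ oU k) (@open_disjoint_itv_is_interval _ _ oU k) ab).
have ap k : a <= (p k).1 by have /andP[/andP[]] := pab k.
have pp k : (p k).1 <= (p k).2 by have /andP[/andP[]] := pab k.
have pb k : (p k).2 <= b by have /andP[] := pab k.
pose s n := [seq p k | k <- iota 0 n].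
have sab n : all (fun x => (a <= x.1) && (x.1 <= x.2) && (x.2 <= b)) (s n).
  by apply/allP => _ /mapP[k _ ->]; rewrite ap pp pb.
have sp n : pairwise (fun x y => (x.2 <= y.1) || (y.2 <= x.1)) (s n).
  rewrite pairwise_map; have := iota_uniq 0 n; rewrite uniq_pairwise; apply: sub_pairwise.
  move=> k l /= kl; have [pk|pk] := pnd k; last by rewrite pk ap.
  have [pl|pl] := pnd l; last by rewrite pl ap orbT.
  apply: contraT; rewrite negb_or -!ltNge => /andP[lk lk'].
  (* The midpoint of the overlap would lie in two disjoint components. *)
  pose m := Num.max (p k).1 (p l).1; pose M := Num.min (p k).2 (p l).2.
  have mM : m < M by rewrite lt_min !gt_max pk pl lk lk'.
  have [mw wM] : m < (m + M) / 2 /\ (m + M) / 2 < M by split; lra.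
  move: mw wM; rewrite gt_max lt_min => /andP[kw lw] /andP[wk wl].
  have /pJ Jk : `](p k).1, (p k).2[%classic ((m + M) / 2) by rewrite /= in_itv/= kw.
  have /pJ Jl : `](p l).1, (p l).2[%classic ((m + M) / 2) by rewrite /= in_itv/= lw.
  have : k = l by apply: tJ => //; exists ((m + M) / 2).
  by move=> /eqP; rewrite (negPf kl).
have slen n : \sum_(x <- s n) (x.2 - x.1) < d.
  rewrite -lte_fin; apply: le_lt_trans Ud.
  rewrite big_map -sumEFin.
  apply: (@le_trans _ _ (\sum_(0 <= k < n) mu (I k `&` `]a, b]))%E).
    rewrite /index_iota subn0; apply: lee_sum => k _.
    apply: (@le_trans _ _ (mu `](p k).1, (p k).2[)).
      rewrite lebesgue_measure_itv/= lte_fin; case: ifPn => [_|]; first by rewrite EFinB.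
      by rewrite -leNgt => h; rewrite lee_fin subr_le0.
    by apply: le_measure; [rewrite inE|rewrite inE; exact: mJ|exact: pJ].
  apply: (le_trans (nneseries_lim_ge (P := xpredT) n _)) => //.
  rewrite -measure_semi_bigcup//; last exact: bigcupT_measurable.
  apply: le_measure; rewrite ?inE; [exact: bigcupT_measurable|exact: open_measurable|].
  by rewrite [X in _ `<=` X](open_disjoint_itv_bigcup oU) => x [k _ [Ik _]]; exists k.
have -> : U `&` `]a, b] = \bigcup_k (I k `&` `]a, b]).
  by rewrite -setI_bigcupl; congr (_ `&` _); exact: open_disjoint_itv_bigcup.
rewrite measure_semi_bigcup//; last exact: bigcupT_measurable.
apply: lime_le; first by apply: is_cvg_nneseries.
apply: nearW => n; apply: (@le_trans _ _ (\sum_(0 <= k < n) nu `](p k).1, (p k).2]%classic)%E).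
  by apply: lee_sum => k _; apply: le_measure; [rewrite inE; exact: mJ|rewrite inE|exact: Jp].
apply: ltW; move: (dg _ (sab n) (sp n) (slen n)); rewrite -lte_fin; apply: le_lt_trans.
rewrite big_map -sumEFin /index_iota subn0; apply: lee_sum => k _.
rewrite stieltjes_itv// /G !clamp_id ?ap ?pb ?(le_trans (pp k)) ?(le_trans _ (pp k))//.
by rewrite lee_fin ler_norm.
Qed.

Let mD : measurable (`]a, b]%classic : set (measurableTypeR R)).
Proof. exact: measurable_itv. Qed.

Let nuD : (nu `]a, b]%classic < +oo)%E.
Proof. by rewrite stieltjes_itv// ltry. Qed.

(** A null set lies in open sets of arbitrarily small Lebesgue measure, whose traces on []a, b]]
    have small Stieltjes measure by [stieltjes_open_le]. The restricted Stieltjes measure is thus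
    dominated by Lebesgue measure, and [h] is its Radon-Nikodym density. *)
Lemma abs_continuous_nondecreasing_density : exists h : R -> R,
  mu.-integrable setT (EFin \o h) /\
  forall x, a <= x <= b -> g x - g a = \int[mu]_(t in `]a, x]) h t.
Proof.
pose nuab : {finite_measure set (measurableTypeR R) -> \bar R} := mfrestr mD nuD.
have dom : nuab `<< (mu : {measure set (measurableTypeR R) -> \bar R}).
  apply/null_content_dominatesP => N mN N0.
  apply/eqP; rewrite eq_le measure_ge0 andbT.
  apply/lee_addgt0Pr => e e0; rewrite add0e.
  have [d d0 dg] := gac e0.
  have [|U [oU NU UN]] := lebesgue_regularity_outer mN _ d0; first by rewrite N0 ltry.
  have Ud : (mu U < d%:E)%E.
    have mU : measurable U by exact: open_measurable.
    apply: le_lt_trans UN; rewrite -[X in (mu X <= _)%E](setDUK NU).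
    apply: (le_trans (measureU2 _ _ _)) => //; first exact: measurableD.
    by rewrite [X in (X + _)%E]N0 add0e.
  apply: le_trans (stieltjes_open_le dg oU Ud).
  rewrite /nuab/= /mfrestr /mrestr; apply: le_measure; rewrite ?inE.
  - exact: measurableI.
  - by apply: measurableI => //; exact: open_measurable.
  - exact: setSI.
have [f [f0 ffin fi fE]] := radon_nikodym_sigma_finite dom.
have fK : EFin \o (fine \o f) = f by apply/funext => x /=; rewrite fineK.
exists (fine \o f); split; first by rewrite fK.
move=> x /andP[ax xb]; apply: EFin_inj.
have -> : (g x - g a)%:E = nuab `]a, x]%classic.
  rewrite /nuab/= /mfrestr /mrestr setIidl; last by apply: subset_itv; rewrite bnd_simp.
  by rewrite [RHS](stieltjes_itv ax) /G !clamp_id ?lexx ?ax.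
rewrite fE; last exact: measurable_itv.
have E : (\int[mu]_(t in `]a, x]) ((fine \o f) t)%:E = \int[mu]_(t in `]a, x]) f t)%E.
  by apply: eq_integral => t _ /=; rewrite fineK.
by rewrite /Rintegral E fineK//; apply: integrable_fin_num => //; exact: integrableS fi.
Qed.

End stieltjes.

(** * Almost everywhere derivative as a density *)

Section abs_continuous_density.
Variable R : realType.
Notation mu := (@lebesgue_measure R).

Lemma abs_continuous_on_density (a b : R) (u : R -> R) : a <= b ->
  abs_continuous_on a b u -> exists h : R -> R,
  mu.-integrable setT (EFin \o h) /\
  forall x, a <= x <= b -> u x - u a = \int[mu]_(t in `]a, x]) h t.
Proof.
move=> ab /abs_continuous_on_nondecreasing_decomposition[f [g [-> fac fnd gac gnd]]].
have [hf [ihf hfE]] := abs_continuous_nondecreasing_density ab fac fnd.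
have [hg [ihg hgE]] := abs_continuous_nondecreasing_density ab gac gnd.
exists (hf \- hg); split.
  by apply: eq_integrable (integrableB measurableT ihf ihg) => // x _; rewrite /= EFinB.
move=> x xab; rewrite RintegralB//; [|exact: integrableS ihf|exact: integrableS ihg].
by rewrite -hfE// -hgE//=; ring.
Qed.

(** At a Lebesgue point of [h] the primitive has derivative [h x], and near [x] it differs from [u]
    by the constant [u a]. *)
Lemma derive1_density (a b : R) (u h : R -> R) :
  mu.-integrable setT (EFin \o h) ->
  (forall x, a <= x <= b -> u x - u a = \int[mu]_(t in `]a, x]) h t) ->
  {ae mu, forall x, a < x < b -> derive1 u x = h x}.
Proof.
move=> ih hE.
have lh : locally_integrable setT h by exact: open_integrable_locally openT _.
have := lebesgue_differentiation lh; apply: filterS; first exact: (ae_filter_ringOfSetsType mu).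
move=> x hx /andP[ax xb].
have ihb : mu.-integrable [set` Interval (BRight a) (BRight b)] (EFin \o h).
  exact: integrableS ih.
have [dF <-] := FTC1_lebesgue_pt xb ihb ax hx.
move: dF; set F := (fun y => _) => dF.
rewrite !derive1E -[RHS]add0r -(derive_cst (u a) x 1) -deriveD//.
apply: near_eq_derive; near=> y.
have ay : a < y by near: y; exact: lt_nbhsr.
have yb : y < b by near: y; exact: lt_nbhsl.
have -> : u y = u a + F y by rewrite /F -hE ?(ltW ay) ?(ltW yb)// addrC subrK.
by [].
Unshelve. all: by end_near. Qed.

End abs_continuous_density.

Section global_density.
Variables (R : realType) (u : R -> R).
Hypothesis uac : loc_abs_continuous_pos u.
Notation mu := (@lebesgue_measure R).

(** [H] is a measurable stand-in for [|u'|]. It glues the densities on the intervals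
    [[1/(n+1), n+2]], which exhaust the half-line: for almost every [x > 0] the cut-off values
    [k n x] are eventually [|u' x|], so their upper limit is too. *)
Lemma loc_abs_continuous_derivative : exists H : R -> R,
  [/\ measurable_fun setT H, forall x, 0 <= H x &
    {ae mu, forall x, 0 < x -> H x = `|derive1 u x|}].
Proof.
pose A n : R := n.+1%:R^-1; pose B n : R := n.+2%:R.
have A0 n : 0 < A n by rewrite invr_gt0.
have AB n : A n <= B n by rewrite (@le_trans _ _ 1) /A /B ?invf_le1 ?ler1n.
have [h /all_and2[ih hE]] := choice (fun n => abs_continuous_on_density (AB n) (uac (A0 n) (AB n))).
have mh n : measurable_fun setT (h n) by have /integrableP[/measurable_EFinP] := ih n.
pose k n x : \bar R := (`|h n x| * \1_(`]A n, B n[) x)%:E.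
have k0 n x : (0 <= k n x)%E by rewrite lee_fin mulr_ge0.
have mk n : measurable_fun setT (k n).
  apply/measurable_EFinP; apply: measurable_funM.
  by apply: measurableT_comp => //; exact: mh.
  exact: measurable_indic.
exists (fun x => fine (limn_esup (k ^~ x))); split.
- apply: (measurableT_comp (f := fine)) => //.
  exact: measurable_fun_limn_esup.
- move=> x; rewrite fine_ge0// limn_esup_lim; apply: lime_ge; first exact: is_cvg_esups.
  by apply: nearW => n; apply: le_trans (k0 n x) _; apply: ereal_sup_ubound; exists n => /=.
- have hae n := derive1_density (ih n) (hE n).
  have : {ae mu, forall x n, A n < x < B n -> derive1 u x = h n x} by exact: ae_foralln.
  apply: filterS; first exact: (ae_filter_ringOfSetsType mu).
  move=> x xP x0.
  suff -> : limn_esup (k ^~ x) = `|derive1 u x|%:E by [].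
  have kx : \forall n \near \oo, k n x = `|derive1 u x|%:E.
    exists (maxn (Num.truncn x) (Num.truncn x^-1)) => // n /=.
    rewrite geq_max => /andP[xn x'n].
    have xAB : A n < x < B n.
      apply/andP; split.
        rewrite /A invf_plt ?posrE//; apply: lt_le_trans (truncnS_gt _) _.
        by rewrite ler_nat.
      by apply: lt_le_trans (truncnS_gt _) _; rewrite ler_nat ltnS leqW.
    by rewrite /k -xP// indicE mem_set ?mulr1//= in_itv/=.
  by apply: (cvg_limn_einf_sup _).2; exact: cvg_near_cst.
Qed.

(** The increment is at most the integral of [|h|] for a local density [h], and [|h| = |u'| = H]
    almost everywhere on []a, b[]. *)
Lemma loc_abs_continuous_le_integral (H : R -> R) (a b : R) :
  measurable_fun setT H -> (forall x, 0 <= H x) ->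
  {ae mu, forall x, 0 < x -> H x = `|derive1 u x|} -> 0 < a -> a <= b ->
  (`|u b - u a|%:E <= \int[mu]_(x in `]a, b[) (H x)%:E)%E.
Proof.
move=> mH H0 Hu a0 ab.
have [h [ih hE]] := abs_continuous_on_density ab (uac a0 ab).
have iab : mu.-integrable `]a, b] (EFin \o h) by exact: integrableS ih.
have mh (D : set R) : measurable_fun D (fun x => (`|h x|)%:E).
  apply: measurable_funTS; apply/measurable_EFinP; apply: measurableT_comp => //.
  by have /integrableP[/measurable_EFinP] := ih.
rewrite hE ?ab ?lexx//.
apply: (@le_trans _ _ (\int[mu]_(x in `]a, b]) (`|h x|)%:E)%E).
  rewrite -abse_EFin /Rintegral fineK; last exact: integrable_fin_num.
  by apply: le_abse_integral => //; have /integrableP[] := iab.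
rewrite -integral_itv_bndo_bndc; last first.
  exact: mh.
rewrite le_eqVlt; apply/orP; left; apply/eqP; apply: ge0_ae_eq_integral => //.
- exact: mh.
- by apply/measurable_EFinP; exact: measurable_funTS.
- by move=> x _; rewrite lee_fin.
- have aeF := ae_filter_ringOfSetsType mu.
  have := @filterI _ _ aeF _ _ Hu (derive1_density ih hE).
  apply: filterS => x [Hx hx] /=; rewrite in_itv/= => /andP[ax xb].
  by rewrite Hx ?(lt_trans a0)// hx ?ax.
Qed.

End global_density.

(** * Comparison with the primitive and conclusion *)

Lemma ae_le_ge0_integral d (T : measurableType d) (R : realType)
    (mu : {measure set T -> \bar R}) (D : set T) (f g : T -> \bar R) :
  measurable D -> measurable_fun D f ->
  (forall x, D x -> 0 <= f x)%E -> (forall x, D x -> 0 <= g x)%E ->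
  {ae mu, forall x, D x -> (f x <= g x)%E} ->
  (\int[mu]_(x in D) f x <= \int[mu]_(x in D) g x)%E.
Proof.
move=> mD mf f0 g0 [N [mN N0 fgN]].
(* Removing the exceptional null set [N] preserves the integral of the measurable [f] and can only
   lower that of [g >= 0]. *)
rewrite (ge0_negligible_integral mN mD mf f0 N0) integral_mkcond [leRHS]integral_mkcond.
apply: le_ge0_integral => x _; rewrite /patch.
  by case: ifPn => //; rewrite inE => -[/f0].
case: ifPn => [|_]; last by case: ifPn => //; rewrite inE => /g0.
rewrite inE => -[Dx Nx]; rewrite mem_set//.
by apply: contrapT => fg; apply: Nx; apply: fgN => /= /(_ Dx).
Qed.

Lemma limf_einf_at_right_eq0 (R : realType) (u : R -> R) (a e s : R) :
  limf_einf (fun r : R => (`|u r|)%:E) (a^'+) = 0%E -> 0 < e -> a < s ->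
  exists2 r, a < r < s & `|u r| < e.
Proof.
rewrite limf_einfE => u0 e0 as_.
have /ereal_inf_lt[_ [r /= rs <-]] : (ereal_inf [set (`|u r|)%:E | r in `]a, s[] < e%:E)%E.
  apply: (@le_lt_trans _ _ 0%E); last by rewrite lte_fin.
  rewrite -u0; apply: ereal_sup_ubound; exists (`]a, s[%classic) => //.
  by near=> r; rewrite /= in_itv/=; apply/andP; split; near: r;
    [exact: nbhs_right_gt|exact: nbhs_right_lt].
by rewrite lte_fin => ue; exists r => //; move: rs; rewrite in_itv.
Unshelve. all: by end_near. Qed.

Unset Implicit Arguments.
Local Open Scope ereal_scope.

Theorem theorem1p1 (R : realType) (p : R) (u : R -> R) :
  (1 < p)%R ->
  loc_abs_continuous_pos u ->
  limf_einf (fun r : R => (`|u r|)%:E) ((0%R : R)^'+) = 0 ->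
  \int[@lebesgue_measure R]_(r in `]0%R, +oo[%classic : set R)
     maxe (ereal_sup [set ((`|u s| `^ p) / (r `^ p))%:E | s in `]0%R, r] ])
          (ereal_sup [set ((`|u s| `^ p) / (s `^ p))%:E | s in `[r, +oo[ ])
   <= ((p / (p - 1)) `^ p)%:E *
      \int[@lebesgue_measure R]_(r in `]0%R, +oo[%classic : set R) ((`|derive1 u r| `^ p)%:E).
Proof.
move=> p1 uac u0.
have p0 : (0 < p)%R by exact: lt_trans ltr01 p1.
have C0 : (0 < (p / (p - 1)) `^ p)%R by rewrite powR_gt0// divr_gt0// subr_gt0.
have [H [mH H0 Hu]] := loc_abs_continuous_derivative uac.
have HpuE : \int[@lebesgue_measure R]_(r in `]0%R, +oo[) (H r `^ p)%:E <=
  \int[@lebesgue_measure R]_(r in `]0%R, +oo[) ((`|derive1 u r| `^ p)%:E).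
  apply: ae_le_ge0_integral => //.
  - exact: measurable_EFin_powR.
  - by move=> x _; rewrite lee_fin powR_ge0.
  - have aeF := ae_filter_ringOfSetsType (@lebesgue_measure R).
    move: Hu; apply: filterS => x Hx; rewrite /= in_itv/= andbT => x0.
    by rewrite Hx.
set RHS := \int[_]_(_ in _) (`|derive1 u _| `^ p)%:E in HpuE *.
(* An infinite right-hand side is trivial because the constant is positive. Otherwise [H^p] has a
   finite integral, as the Hardy inequality requires. *)
have [RHSy|] := ltP RHS +oo; last first.
  by rewrite leye_eq => /eqP ->; rewrite gt0_muley ?leey// lte_fin.
apply: le_trans (lee_wpmul2l _ HpuE); last by rewrite lee_fin ltW.
have Hp : \int[@lebesgue_measure R]_(r in `[0%R, +oo[) (H r `^ p)%:E < +oo.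
  rewrite -integral_itv_obnd_cbnd; last exact: measurable_EFin_powR.
  exact: le_lt_trans HpuE RHSy.
pose F (s : R) : R := (\int[@lebesgue_measure R]_(x in `[0, s[) H x)%R.
have FE := EFin_primitive p1 mH H0 Hp; have F_nd := nondecreasing_primitive p1 mH H0 Hp.
have F0 : forall s, (0 <= F s)%R := primitive_ge0 H0.
have uF s : (0 < s)%R -> (`|u s| <= F s)%R.
  move=> s0; apply/ler_addgt0Pr => e e0.
  (* A point [r] near [0] with [|u r| < e] gives [|u s| <= |u s - u r| + e], and the increment is at
     most the integral of [H] over []r, s[], hence at most [F s]. *)
  have [r /andP[r0 rs] ur] := limf_einf_at_right_eq0 u0 e0 s0.
  rewrite -(subrK (u r) (u s)); apply: le_trans (ler_normD _ _) _.
  apply: lerD; last exact: ltW.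
  rewrite -lee_fin FE.
  apply: le_trans (loc_abs_continuous_le_integral uac mH H0 Hu r0 (ltW rs)) _.
  apply: ge0_subset_integral => //.
  - by apply/measurable_EFinP; exact: measurable_funTS.
  - by move=> x _; rewrite lee_fin.
  - by apply: subset_itv; rewrite bnd_simp// ltW.
apply: le_trans (hardy_tail_sup p1 mH H0 Hp).
apply: le_ge0_integral => r; rewrite /= in_itv/= andbT => r0.
  rewrite le_max; apply/orP; left; apply: (@le_trans _ _ ((`|u r| `^ p) / (r `^ p))%:E).
    by rewrite lee_fin divr_ge0// powR_ge0.
  by apply: ereal_sup_ubound; exists r => //=; rewrite in_itv/= r0 lexx.
have uFdiv s t : (0 < s)%R -> (s <= t)%R -> ((`|u s| `^ p) / (t `^ p) <= (F t / t) `^ p)%R.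
  move=> s0 st; have t0 := lt_le_trans s0 st.
  rewrite ler_pdivrMr ?powR_gt0// -powRM ?divr_ge0 ?(ltW t0)// divfK ?gt_eqF//.
  by apply: ge0_ler_powR; rewrite ?nnegrE ?(ltW p0)// (le_trans (uF _ s0)) ?F_nd.
rewrite ge_max; apply/andP; split.
  (* For [s <= r], monotonicity of [F] gives the bound [(F r / r)^p], which is the member at [r] of
     the supremum over [[r, +oo[]. *)
  apply: ge_ereal_sup => _ [s + <-]; rewrite /= in_itv/= => /andP[s0 sr].
  apply: (@le_trans _ _ ((F r / r) `^ p)%:E); first by rewrite lee_fin uFdiv.
  by apply: ereal_sup_ubound; exists r => //=; rewrite in_itv/= lexx.
apply: ge_ereal_sup => _ [s + <-]; rewrite /= in_itv/= andbT => rs.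
have s0 := lt_le_trans r0 rs.
apply: (@le_trans _ _ ((F s / s) `^ p)%:E); first by rewrite lee_fin uFdiv.
by apply: ereal_sup_ubound; exists s => //=; rewrite in_itv/= rs.
Qed.
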